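(* Let $p$ be a prime number, let $R=\bigoplus_{n\ge 0}R_n$ be a Noetherian commutative graded ring such that $k:=R_0$ is a field of characteristic $p$, and let $K$ be the perfect closure of $k$. Assume that $R_K:=R\otimes_k K$ (graded by $[R_K]_n=R_n\otimes_k K$) has finite graded F-representation type. Then for every non-zerodivisor $x\in R$, the localization $R_x$ is generated by $1/x$ as a $D_{R/k}$-module.
   Context: All rings are Noetherian commutative rings with identity, of prime characteristic $p$; $\mathbb{N}$ denotes the nonnegative integers. For an $R$-module $M$ and $e\ge 0$, ${}^eM$ denotes $M$ as an abelian group with the $R$-module structure $r\cdot m:=r^{p^e}m$. If $R=\bigoplus_{n\ge0}R_n$ is graded and $M$ is a graded $R$-module, ${}^eM$ is $\mathbb{Q}$-graded by $[{}^eM]_\alpha=[M]_{p^e\alpha}$ if $\alpha$ is an integer multiple of $1/p^e$, and $[{}^eM]_\alpha=0$ otherwise. For a $\mathbb{Q}$-graded module $N$ and $\alpha\in\mathbb{Q}$, $N(\alpha)$ denotes the shifted module, $[N(\alpha)]_\beta=[N]_{\alpha+\beta}$. A Noetherian graded ring $R=\bigoplus_{n\ge0}R_n$ of characteristic $p$ has finite graded F-representation type by finitely generated $\mathbb{Q}$-graded $R$-modules $M_1,\dots,M_s$ if for every $e\in\mathbb{N}$ there exist nonnegative integers $n_{ei}$ ($1\le i\le s$) and rational numbers $\alpha^{(e)}_{ij}$ ($1\le i\le s$, $1\le j\le n_{ei}$) and a $\mathbb{Q}$-graded (degree-preserving) isomorphism of $R$-modules ${}^eR\cong\bigoplus_{i=1}^s\bigoplus_{j=1}^{n_{ei}}M_i(\alpha^{(e)}_{ij})$.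 It has finite graded F-representation type if such $M_1,\dots,M_s$ exist. For a commutative $k$-algebra $R$, the ring of $k$-linear differential operators is $D_{R/k}=\bigcup_{n\ge0}D^n_{R/k}\subseteq\mathrm{End}_k(R)$, where $D^{-1}_{R/k}=0$ and $D^{n+1}_{R/k}=\{\delta\in\mathrm{Hom}_k(R,R)\mid[\delta,r]\in D^n_{R/k}\text{ for all }r\in R\}$, with $[\delta,r]=\delta\circ r-r\circ\delta$ ($r$ viewed as the multiplication operator). In characteristic $p$ every $\delta\in D_{R/k}$ is $R^{q}$-linear for all sufficiently large $q=p^e$, where $R^q=\{r^q\mid r\in R\}$. The localization $R_x$ has the unique $D_{R/k}$-module structure for which $R\to R_x$ is $D_{R/k}$-linear: for $\delta\in D_{R/k}$ and $q=p^e\gg0$ with $\delta$ being $R^q$-linear, $\delta(y/s)=\delta(s^{q-1}y)/s^q$ for $y\in R$ and $s$ a power of $x$. *)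

(* Defs.v *)
From HB Require Import structures.
From mathcomp Require Import all_boot all_algebra.
From mathcomp Require Import ring.
From mathcomp Require Import boolp classical_sets.

Set Implicit Arguments.
Unset Strict Implicit.
Unset Printing Implicit Defensive.

Import GRing.Theory.
Local Open Scope classical_set_scope.
Local Open Scope ring_scope.

Definition is_ideal (R : comNzRingType) (J : set R) : Prop :=
  [/\ J 0, forall a b, J a -> J b -> J (a + b) & forall r a, J a -> J (r * a)].

Definition noetherian (R : comNzRingType) : Prop :=
  forall J : set R, is_ideal J ->
  exists (m : nat) (a : 'I_m -> R),
    forall r, J r <-> exists c : 'I_m -> R, r = \sum_i c i * a i.

Definition finitely_generated (R : comNzRingType) (M : lmodType R) : Prop :=
  exists (m : nat) (a : 'I_m -> M),
    forall v, exists c : 'I_m -> R, v = \sum_i c i *: a i.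

(* V is the internal direct sum of the subgroups g i. *)
Record direct_decomposition (I : eqType) (V : zmodType) (g : I -> set V) :
    Prop := DirectDecomposition {
  comp0 : forall i, g i 0;
  compB : forall i u v, g i u -> g i v -> g i (u - v);
  comp_span : forall v, exists (s : seq I) (c : I -> V),
    [/\ uniq s, forall i, g i (c i) & v = \sum_(i <- s) c i];
  comp_free : forall (s : seq I) (c : I -> V), uniq s ->
    (forall i, g i (c i)) -> \sum_(i <- s) c i = 0 ->
    forall i, i \in s -> c i = 0
}.

Record noetherian_graded_ring (p : nat) (R : comNzRingType)
    (g : nat -> set R) : Prop := NoetherianGradedRing {
  ngr_pchar : p \in [pchar R];
  ngr_noetherian : noetherian R;
  ngr_decomp : direct_decomposition g;
  ngr_mul : forall m n a b, g m a -> g n b -> g (m + n)%N (a * b)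
}.

Record Qgraded_module (R : comNzRingType) (g : nat -> set R)
    (M : lmodType R) (h : rat -> set M) : Prop := QgradedModule {
  qgm_decomp : direct_decomposition h;
  qgm_scale : forall (n : nat) (b : rat) r v,
    g n r -> h b v -> h (n%:R + b) (r *: v)
}.

(* frobM chR e M is M with the R-module structure r . m = r ^+ (p ^ e) *: m. *)
Definition frobM (p : nat) (R : comNzRingType) (chR : p \in [pchar R])
  (e : nat) (M : lmodType R) : Type := M.

HB.instance Definition _ (p : nat) (R : comNzRingType)
  (chR : p \in [pchar R]) (e : nat) (M : lmodType R) :=
  GRing.Zmodule.on (frobM chR e M).

Definition frob_scale (p : nat) (R : comNzRingType) (chR : p \in [pchar R])
  (e : nat) (M : lmodType R) (r : R) (m : frobM chR e M) : frobM chR e M :=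
  (r ^+ (p ^ e)) *: (m : M).

Fact frob_scaleA (p : nat) (R : comNzRingType) (chR : p \in [pchar R])
  (e : nat) (M : lmodType R) (a b : R) (m : frobM chR e M) :
  frob_scale a (frob_scale b m) = frob_scale (a * b) m.
Proof. by rewrite /frob_scale scalerA exprMn. Qed.

Fact frob_scale1 (p : nat) (R : comNzRingType) (chR : p \in [pchar R])
  (e : nat) (M : lmodType R) : left_id 1 (@frob_scale p R chR e M).
Proof. by move=> m; rewrite /frob_scale expr1n scale1r. Qed.

Fact frob_scaleDr (p : nat) (R : comNzRingType) (chR : p \in [pchar R])
  (e : nat) (M : lmodType R) :
  right_distributive (@frob_scale p R chR e M) +%R.
Proof. by move=> r m n; rewrite /frob_scale scalerDr. Qed.

Fact frob_scaleDl (p : nat) (R : comNzRingType) (chR : p \in [pchar R])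
  (e : nat) (M : lmodType R) (m : frobM chR e M) :
  {morph (@frob_scale p R chR e M)^~ m : a b / a + b}.
Proof.
move=> a b; rewrite /frob_scale -scalerDl; congr (_ *: _).
elim: e {m} => [|e IHe]; first by rewrite expn0 !expr1.
by rewrite expnSr !exprM IHe -!(pFrobenius_autE chR) rmorphD.
Qed.

HB.instance Definition _ (p : nat) (R : comNzRingType)
  (chR : p \in [pchar R]) (e : nat) (M : lmodType R) :=
  GRing.Zmodule_isLmodule.Build R (frobM chR e M)
    (@frob_scaleA p R chR e M) (@frob_scale1 p R chR e M)
    (@frob_scaleDr p R chR e M) (@frob_scaleDl p R chR e M).

(* The degree a component of ^eR: it is R_(p^e a) when p^e a is a natural
   number, and 0 otherwise (in particular when p^e a is a negative integer,
   R being graded by the natural numbers). *)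
Definition frob_grading (p : nat) (R : comNzRingType) (g : nat -> set R)
  (e : nat) (a : rat) : set R :=
  [set r | r = 0 \/ exists2 n : nat, (p ^ e)%:R * a = n%:R & g n r].

(* A homomorphism from ^eR to the direct sum of the shifts M_i(alpha i j) is
   given by the family of its coordinates phi i j. *)
Definition graded_FFRT_by (p : nat) (R : comNzRingType) (g : nat -> set R)
  (chR : p \in [pchar R]) (s : nat) (M : 'I_s -> lmodType R)
  (h : forall i, rat -> set (M i)) : Prop :=
  (forall i, finitely_generated (M i) /\ Qgraded_module g (h i)) /\
  forall e : nat, exists (n : 'I_s -> nat) (alpha : forall i, 'I_(n i) -> rat)
      (phi : forall i, 'I_(n i) -> {linear frobM chR e R^o -> M i}),
    bijective (fun (r : R) i (j : 'I_(n i)) => phi i j r) /\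
    forall (b : rat) (r : R),
      frob_grading p g e b r <->
      (forall i (j : 'I_(n i)), h i (alpha i j + b) (phi i j r)).

Definition has_graded_FFRT (p : nat) (R : comNzRingType) (g : nat -> set R) :
    Prop :=
  exists H : noetherian_graded_ring p g,
  exists (s : nat) (M : 'I_s -> lmodType R) (h : forall i, rat -> set (M i)),
    graded_FFRT_by g (ngr_pchar H) h.

Record is_perfect_closure (p : nat) (k K : fieldType)
    (i : {rmorphism k -> K}) : Prop := IsPerfectClosure {
  pc_perfect : forall a : K, exists b : K, b ^+ p = a;
  pc_insep : forall a : K, exists (n : nat) (c : k), a ^+ (p ^ n) = i c
}.

(* K is a k-module through i. *)
Definition k_bilinear (k K : fieldType) (i : {rmorphism k -> K})
  (R V : lmodType k) (b : R -> K -> V) : Prop :=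
  (forall a c r r', b (c *: r + r') a = c *: b r a + b r' a) /\
  (forall r c a a', b r (i c * a + a') = c *: b r a + b r a').

(* RK, with r (x) a := a *: j r, is the k-algebra R (x)_k K: the ring and
   K-algebra structures satisfy (r (x) a) (r' (x) a') = rr' (x) aa', and
   (r, a) |-> r (x) a is the universal k-bilinear map on R x K. *)
Definition is_tensor_algebra (k K : fieldType) (i : {rmorphism k -> K})
  (R : comAlgType k) (RK : comAlgType K) (j : {rmorphism R -> RK}) : Prop :=
  (forall (c : k) (r : R), j (c *: r) = i c *: j r) /\
  forall (V : lmodType k) (b : R -> K -> V), k_bilinear i b ->
    exists! F : RK -> V,
      (forall c z z', F (i c *: z + z') = c *: F z + F z') /\
      (forall r a, F (a *: j r) = b r a).

Definition tensor_grading (k K : fieldType) (R : comAlgType k)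
  (RK : comAlgType K) (j : {rmorphism R -> RK}) (g : nat -> set R) (n : nat) :
  set RK :=
  [set z | exists (m : nat) (r : 'I_m -> R) (a : 'I_m -> K),
     (forall l, g n (r l)) /\ z = \sum_l a l *: j (r l)].

(* diffop_lt n is D^(n-1); in particular diffop_lt 0 is D^(-1) = 0. *)
Fixpoint diffop_lt (k : fieldType) (R : comAlgType k) (n : nat)
    (d : R -> R) : Prop :=
  match n with
  | 0%N => forall y, d y = 0
  | n'.+1 => (forall (c : k) y z, d (c *: y + z) = c *: d y + d z) /\
             (forall r, diffop_lt n' (fun y => d (r * y) - r * d y))
  end.

Definition diffop (k : fieldType) (R : comAlgType k) (d : R -> R) : Prop :=
  exists n, diffop_lt n d.

Record is_localization (R : comNzRingType) (x : R) (L : comUnitRingType)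
    (f : {rmorphism R -> L}) : Prop := IsLocalization {
  loc_unit : f x \is a GRing.unit;
  loc_surj : forall u : L, exists (y : R) (n : nat), u = f y / f (x ^+ n);
  loc_ker : forall y : R, f y = 0 -> exists n : nat, x ^+ n * y = 0
}.

Definition frob_linear (p e : nat) (R : comNzRingType) (d : R -> R) : Prop :=
  forall r y, d (r ^+ (p ^ e) * y) = r ^+ (p ^ e) * d y.

Definition loc_act_graph (p : nat) (R : comNzRingType) (x : R)
  (L : comUnitRingType) (f : {rmorphism R -> L}) (d : R -> R) (u v : L) :
  Prop :=
  exists (e n : nat) (y : R),
    [/\ frob_linear p e d, u = f y / f (x ^+ n) &
        v = f (d ((x ^+ n) ^+ (p ^ e).-1 * y)) / f ((x ^+ n) ^+ (p ^ e))].

(* The action of a differential operator d on R_x. Some q = p ^ e for which d is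
   R^q-linear exists by diffop_frob_linear, and by loc_actE the value
   depends neither on the choice of q nor on that of the fraction. *)
Definition loc_act (p : nat) (R : comNzRingType) (x : R)
  (L : comUnitRingType) (f : {rmorphism R -> L}) (d : R -> R) (u : L) : L :=
  xget 0 [set v | loc_act_graph p x f d u v].

Lemma loc_act_graph_le (p e e' : nat) (R : comNzRingType) (x : R)
    (L : comUnitRingType) (f : {rmorphism R -> L}) (d : R -> R) (n : nat)
    (y : R) :
  (0 < p)%N -> (e <= e')%N -> is_localization x f -> frob_linear p e d ->
  f (d ((x ^+ n) ^+ (p ^ e).-1 * y)) / f ((x ^+ n) ^+ (p ^ e)) =
  f (d ((x ^+ n) ^+ (p ^ e').-1 * y)) / f ((x ^+ n) ^+ (p ^ e')).
Proof.
move=> p0 /subnKC<- Lx de; set s := x ^+ n; set q := (p ^ e)%N.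
have Us m : f (s ^+ m) \is a GRing.unit.
  by rewrite !rmorphXn !unitrX// (loc_unit Lx).
rewrite expnD -/q; set Q := (p ^ _)%N.
have q0 : (0 < q)%N by rewrite expn_gt0 p0.
have Q0 : (0 < Q)%N by rewrite expn_gt0 p0.
have E : (q * Q = q * Q.-1 + q)%N by rewrite -mulnSr prednK.
have -> : (q * Q).-1 = (Q.-1 * q + q.-1)%N.
  by rewrite E mulnC -!subn1 addnBA.
rewrite exprD exprM -mulrA de -exprM rmorphM E mulnC exprD.
by rewrite rmorphM invrM// [f _ * f (d _)]mulrC mulrACA mulrV// mulr1.
Qed.

Lemma frob_linear_le (p e e' : nat) (R : comNzRingType) (d : R -> R) :
  (e <= e')%N -> frob_linear p e d -> frob_linear p e' d.
Proof.
move=> /subnK<- de r y; rewrite expnD exprM; exact: de.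
Qed.

Lemma loc_actE (p : nat) (R : comNzRingType) (x : R) (L : comUnitRingType)
    (f : {rmorphism R -> L}) (d : R -> R) (e n : nat) (y : R) :
  (0 < p)%N -> is_localization x f -> frob_linear p e d ->
  loc_act p x f d (f y / f (x ^+ n)) =
  f (d ((x ^+ n) ^+ (p ^ e).-1 * y)) / f ((x ^+ n) ^+ (p ^ e)).
Proof.
move=> p0 Lx de; rewrite /loc_act.
case: xgetP => [v _ [e' [n' [y' [de' uE ->]]]]|/(_ (f (d ((x ^+ n) ^+
  (p ^ e).-1 * y)) / f ((x ^+ n) ^+ (p ^ e))))]; last first.
  by case; exists e, n, y; split.
pose E := maxn e e'; have dE : frob_linear p E d.
  exact: frob_linear_le (leq_maxl _ _) de.
rewrite (loc_act_graph_le _ _ p0 (leq_maxr e e') Lx de').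
rewrite (loc_act_graph_le _ _ p0 (leq_maxl e e') Lx de) -/E.
move: uE; set s := x ^+ n; set s' := x ^+ n'; set q := (p ^ E)%N => uE.
have q0 : (0 < q)%N by rewrite expn_gt0 p0.
have Us m : f (x ^+ m) \is a GRing.unit.
  by rewrite !rmorphXn !unitrX// (loc_unit Lx).
have {}uE : f (s' * y - s * y') = 0.
  apply/eqP; rewrite rmorphB !rmorphM subr_eq0; apply/eqP.
  rewrite -[f y](divrK (Us n)) -/s uE mulrA [f s' * _]mulrC.
  by rewrite divrK 1?mulrC// Us.
have [m /eqP] := loc_ker Lx uE.
rewrite mulrBr subr_eq0 => /eqP; set t := x ^+ m => tE.
have Uq z : f ((x ^+ z) ^+ q) \is a GRing.unit by rewrite -exprM Us.
suff : f (t ^+ q * (s ^+ q * d (s' ^+ q.-1 * y'))) =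
       f (t ^+ q * (s' ^+ q * d (s ^+ q.-1 * y))).
  rewrite !rmorphM => /(mulrI (Uq m)) H.
  apply: (mulrI (Uq n')); rewrite mulrC (divrK (Uq n')).
  apply: (mulrI (Uq n)); rewrite H [RHS]mulrCA.
  by congr (_ * _); rewrite [RHS]mulrC (divrK (Uq n)).
congr (f _); rewrite -!dE; congr d.
have eq z : z ^+ q = z ^+ q.-1 * z by rewrite -exprSr prednK.
rewrite !eq; move: (t ^+ _) (s ^+ _) (s' ^+ _) => a b c.
transitivity (a * b * c * (t * (s * y'))); first by ring.
by rewrite -tE; ring.
Qed.

Lemma diffop_frob_linear (p : nat) (k : fieldType) (R : comAlgType k)
    (n : nat) (d : R -> R) :
  p \in [pchar R] -> diffop_lt n d -> frob_linear p n d.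
Proof.
move=> chR; elim: n d => [|n IHn] d /=.
  by move=> d0 r y; rewrite !d0 mulr0.
move=> [_ dr] r y; rewrite expnSr exprM; set s := r ^+ (p ^ n).
have dE z : d (s * z) = s * d z + (d (s * z) - s * d z) by rewrite addrC subrK.
pose E z := d (s * z) - s * d z.
have Es z : E (s * z) = s * E z by exact: (IHn _ (dr s)).
have Esm m z : E (s ^+ m * z) = s ^+ m * E z.
  by elim: m => [|m IHm]; rewrite ?expr0 ?mul1r// exprS -mulrA Es IHm mulrA.
suff dm m : d (s ^+ m * y) = s ^+ m * d y + (s ^+ m.-1 * E y) *+ m.
  by rewrite dm -mulr_natr (pcharf0 chR) mulr0 addr0.
elim: m => [|m IHm]; first by rewrite !expr0 !mul1r addr0.
rewrite exprS -mulrA dE -/(E _) Esm IHm mulrDr mulrA -addrA; congr (_ + _).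
rewrite mulrSr /= -mulrnAr; congr (_ + _).
by case: m {IHm} => [|m]; rewrite ?mulr0n ?mulr0// !mulrnAr mulrA -exprS.
Qed.

(* Main.v *)
(* Over the perfect field K, let N_i(e) be the set of images of x^(q-1),
   q = p^e, under the homomorphisms ^eR_K -> M_i.  Composing with
   r |-> x^(p-1) r^p shows that N_i(e) decreases with e.  The shifts occurring in
   ^eR_K are bounded above since ^eR_K lives in nonnegative degrees, so all the
   coordinates of the x^(q-q') lie in a finite-dimensional subspace of M_i, on
   which N_i(e) stabilizes.  The coordinates of x^(q-q') = (x^(q/q'-1))^q' lie in
   N_i(e-e'), hence in N_i(e) when e - e' is large: there is an R_K^q-linear map
   sending x^(q-1) to x^(q-q').  A k-linear retraction of K onto k turns it into
   a k-linear, R^q-linear map of R, which is a differential operator because R is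
   a finitely generated k-algebra; it sends 1/x to 1/x^q'. *)
Require Import Defs.
From mathcomp Require Import all_boot all_order all_algebra.
From mathcomp Require Import ring.
From mathcomp Require Import boolp classical_sets.

Set Implicit Arguments.
Unset Strict Implicit.
Unset Printing Implicit Defensive.

Import Order.TTheory GRing.Theory Num.Theory.
Local Open Scope classical_set_scope.
Local Open Scope ring_scope.

(** * Finite sums of elements of a subset *)

Inductive sums (V : nmodType) (G : set V) : V -> Prop :=
| sums_zero : sums G 0
| sums_cons u v : G u -> sums G v -> sums G (u + v).

Lemma sums_in (V : nmodType) (G : set V) u : G u -> sums G u.
Proof. by move=> Gu; rewrite -[u]addr0; apply: sums_cons => //; constructor. Qed.

Lemma sumsD (V : nmodType) (G : set V) u v :
  sums G u -> sums G v -> sums G (u + v).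
Proof.
by move=> Su Sv; elim: Su => [|u' w Gu _ IH]; rewrite ?add0r// -addrA; constructor.
Qed.

Lemma sums_min (V : nmodType) (G S : set V) :
  S 0 -> (forall u v, S u -> S v -> S (u + v)) -> G `<=` S -> sums G `<=` S.
Proof. by move=> S0 SD GS v; elim=> // u w /GS Su _; apply: SD. Qed.

Lemma sums_sum (V : nmodType) (G : set V) (I : Type) (r : seq I) (P : pred I)
  (F : I -> V) :
  (forall i, P i -> sums G (F i)) -> sums G (\sum_(i <- r | P i) F i).
Proof. by move=> FG; apply: big_ind => //; [constructor | exact: sumsD]. Qed.

(** * Homogeneous components in a direct decomposition *)

Section Decomposition.
Variables (I : eqType) (V : zmodType) (g : I -> set V).
Hypothesis dg : direct_decomposition g.

Lemma compD i u v : g i u -> g i v -> g i (u + v).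
Proof.
move=> gu gv; rewrite -[v]opprK; apply: (compB dg) => //.
by rewrite -sub0r; apply: (compB dg) => //; exact: comp0.
Qed.

Lemma decomp_sums v : sums [set w | exists i, g i w] v.
Proof.
have [s [c [_ gc ->]]] := comp_span dg v.
by apply: sums_sum => i _; apply: sums_in; exists i.
Qed.

(** As [c] vanishes off [s], the list can be enlarged at will and [c] is determined by [v] as a
    function on all of [I]. *)
Let in_decomp v (s : seq I) (c : I -> V) :=
  [/\ uniq s, forall i, g i (c i), forall i, i \notin s -> c i = 0 &
      v = \sum_(i <- s) c i].

Let in_decomp_ext v s c s' : in_decomp v s c -> uniq s' -> {subset s <= s'} ->
  in_decomp v s' c.
Proof.
case=> us gc c0 -> us' ss'; split=> //.
  by move=> i is'; apply: c0; apply: contra is' => /ss'.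
rewrite [RHS](bigID (fun i => i \in s))/= [X in _ + X]big1// addr0.
rewrite -[RHS]big_filter; apply: perm_big.
apply: uniq_perm => //; first exact: filter_uniq.
move=> i; rewrite mem_filter; case: (boolP (i \in s)) => //= /ss' -> //.
Qed.

Let in_decomp_inj u v s c s' c' : in_decomp u s c -> in_decomp v s' c' ->
  u = v -> c =1 c'.
Proof.
move=> us vs' uv i; pose t := undup (s ++ s').
have [] : in_decomp u t c.
  by apply: in_decomp_ext us (undup_uniq _) _ => j; rewrite mem_undup mem_cat => ->.
move=> ut gc c0 uE.
have [] : in_decomp v t c'.
  apply: in_decomp_ext vs' (undup_uniq _) _ => j.
  by rewrite mem_undup mem_cat orbC => ->.
move=> _ gc' c0' vE.
have [it|it] := boolP (i \in t); last by rewrite c0 ?c0'.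
apply/eqP; rewrite -subr_eq0; apply/eqP.
apply: (@comp_free _ _ _ dg t (fun j => c j - c' j)) => //.
- by move=> j; exact: (compB dg).
- by rewrite sumrB -uE -vE uv subrr.
Qed.

(** The component maps: a decomposition is chosen for each element, and uniqueness, checked on a
    common support, forces additivity. *)
Lemma projection_exists : exists P : I -> V -> V,
  [/\ forall i u v, P i (u + v) = P i u + P i v,
      forall i v, g i v -> P i v = v &
      forall i i' v, i' != i -> g i' v -> P i v = 0].
Proof.
have /choice[P dP] : forall v, exists c, exists s, in_decomp v s c.
  move=> v; have [s [c [us gc ->]]] := comp_span dg v.
  exists (fun i => if i \in s then c i else 0), s; split=> //.
  - by move=> i; case: ifP => // _; exact: (comp0 dg).
  - by move=> i /negbTE->.
  - by apply: eq_big_seq => i ->.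
have Puniq v s c : in_decomp v s c -> P v =1 c.
  by case: (dP v) => s' ds' ds; exact: in_decomp_inj ds' ds erefl.
have Phom i v : g i v -> P v =1 (fun l => if l == i then v else 0).
  move=> gv; apply: (Puniq _ [:: i]); split=> //.
  - by move=> l; case: eqP => [->|] // _; exact: (comp0 dg).
  - by move=> l; rewrite inE => /negbTE->.
  - by rewrite big_seq1 eqxx.
exists (fun i v => P v i); split.
- move=> i u v; have [s us] := dP u; have [s' vs'] := dP v.
  pose t := undup (s ++ s').
  have [] : in_decomp u t (P u).
    by apply: in_decomp_ext us (undup_uniq _) _ => j; rewrite mem_undup mem_cat => ->.
  move=> ut gc c0 uE.
  have [] : in_decomp v t (P v).
    apply: in_decomp_ext vs' (undup_uniq _) _ => j.
    by rewrite mem_undup mem_cat orbC => ->.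
  move=> _ gc' c0' vE.
  apply: (Puniq _ t (fun l => P u l + P v l)); split=> //.
  + by move=> l; exact: compD.
  + by move=> l lt; rewrite c0 ?c0' ?addr0.
  + by rewrite big_split/= -uE -vE.
- by move=> i v gv; rewrite (Phom i v gv) eqxx.
- by move=> i i' v ii' gv; rewrite (Phom i' v gv) eq_sym (negbTE ii').
Qed.

End Decomposition.

(** * Generators of a Noetherian graded ring *)

Section GradedRing.
Variables (A : comNzRingType) (g : nat -> set A).
Hypothesis noethA : noetherian A.
Hypothesis dg : direct_decomposition g.
Hypothesis gM : forall m n a b, g m a -> g n b -> g (m + n)%N (a * b).

(** Noetherianity applies to the ideal [I] of elements generated by some finite list of homogeneous
    elements of positive degree. Each of its finitely many generators needs one such list; these
    lists are concatenated. *)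
Lemma irrelevant_ideal_fg : exists ys : seq A,
  (forall y, y \in ys -> exists2 d, (0 < d)%N & g d y) /\
  forall J : set A, is_ideal J -> (forall y, y \in ys -> J y) ->
  forall n v, (0 < n)%N -> g n v -> J v.
Proof.
pose homog (ys : seq A) := forall y, y \in ys -> exists2 d, (0 < d)%N & g d y.
pose gen (ys : seq A) : set A := [set v | forall J : set A, is_ideal J ->
  (forall y, y \in ys -> J y) -> J v].
pose I : set A := [set v | exists2 ys, homog ys & gen ys v].
have idI : is_ideal I.
  split.
  - by exists [::] => // J [].
  - move=> a b [ys ysh ga] [zs zsh gb]; exists (ys ++ zs).
      by move=> y; rewrite mem_cat => /orP[/ysh|/zsh].
    move=> J idJ Jyz; have [_ JD _] := idJ; apply: JD.
      by apply: ga => // y yys; apply: Jyz; rewrite mem_cat yys.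
    by apply: gb => // y yzs; apply: Jyz; rewrite mem_cat yzs orbT.
  - move=> r a [ys ysh ga]; exists ys => // J idJ Jys; have [_ _ JM] := idJ.
    by apply: JM; exact: ga.
have [m [a Ia]] := noethA idI.
have /choice[F FP] : forall t, exists ys, homog ys /\ gen ys (a t).
  move=> t; suff [ys] : I (a t) by exists ys.
  apply/Ia; exists (fun l => if l == t then 1 else 0).
  by rewrite (bigD1 t)//= eqxx mul1r big1 ?addr0// => l /negbTE->; rewrite mul0r.
exists (flatten [seq F t | t <- enum 'I_m]); split.
  by move=> y /flatten_mapP[t _]; case: (FP t) => + _ => /[apply].
move=> J idJ Jys n v n0 gv; have [J0 JD JM] := idJ.
have /Ia[c ->] : I v.
  exists [:: v]; first by move=> y; rewrite inE => /eqP->; exists n.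
  by move=> ? _; apply; rewrite inE.
apply: big_ind => // t _; apply: JM; have [_] := FP t; apply => // y yF.
by apply: Jys; apply/flatten_mapP; exists t; rewrite ?mem_enum.
Qed.

(** Taking degree [N] components in a combination of the positive-degree generators makes the
    coefficients homogeneous, of degree below [N]. *)
Lemma graded_generators : exists ys : seq A, forall N v, (0 < N)%N -> g N v ->
  sums [set z | exists y r n, [/\ y \in ys, (n < N)%N, g n r & z = r * y]] v.
Proof.
have [ys [ysh ysgen]] := irrelevant_ideal_fg; exists ys => N v N0 gv.
set S := (X in sums X).
have [P [PD Pid P0]] := projection_exists dg.
(* The quantifier over [r] makes [J] an ideal, so only the generators remain to be treated; [r = 1]
   gives back [v]. *)
pose J : set A := [set u | forall r, sums S (P N (r * u))].
suff /(_ 1) : J v by rewrite mul1r Pid.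
apply: ysgen N0 gv.
  split.
  - by move=> r; rewrite mulr0 Pid; [constructor | exact: (comp0 dg)].
  - by move=> a b Ja Jb r; rewrite mulrDr PD; exact: sumsD.
  - by move=> r a Ja r'; rewrite mulrA.
move=> y yys r; have [d d0 gy] := ysh y yys.
elim: {r}(decomp_sums dg r) => [|u w [n gu] _ IH].
  by rewrite mul0r Pid; [constructor | exact: (comp0 dg)].
rewrite mulrDl PD; apply: sumsD => //.
have guy := gM gu gy; have [nd|nd] := eqVneq (n + d)%N N.
  rewrite Pid -?nd//; apply: sums_in; exists y, u, n; split=> //.
  by rewrite -nd -[X in (X < _)%N]addn0 ltn_add2l.
by rewrite (P0 _ _ _ nd guy); constructor.
Qed.

(** Strong induction on the degree. The conclusion is an induction principle: the ring is generated
    by [ys] as an algebra over its degree 0 part. *)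
Lemma graded_algebra_fg : exists ys : seq A, forall S : set A,
  (forall u v, S u -> S v -> S (u + v)) ->
  (forall u v, S u -> S v -> S (u * v)) ->
  (forall u, g 0%N u -> S u) -> (forall y, y \in ys -> S y) -> forall v, S v.
Proof.
have [ys gen] := graded_generators; exists ys => S SD SM Sg0 Sys v.
have S0 : S 0 by apply/Sg0/(comp0 dg).
apply: sums_min (decomp_sums dg v) => // {}v [n].
elim/ltn_ind: n v => -[|n] IH v gv; first exact: Sg0.
apply: sums_min (gen n.+1 v erefl gv) => // _ [y [r [l [yys ln gr ->]]]].
by apply: SM; [exact: IH gr | exact: Sys].
Qed.

End GradedRing.

(** * Finite-dimensional subspaces and descending chains *)

Section FiniteSpan.
Variables (K : fieldType) (A : comAlgType K).

(** [M] carries only an [A]-module structure, so [K] acts through the scalars [a%:A]. *)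
Definition kspan (M : lmodType A) (s : seq M) : set M :=
  sums [set v | exists (a : K) w, w \in s /\ v = a%:A *: w].

Lemma kspan_sub (M : lmodType A) (s t : seq M) :
  {subset s <= t} -> kspan s `<=` kspan t.
Proof.
move=> st; apply: sums_min; [constructor | exact: sumsD |].
by move=> _ [a [w [/st wt ->]]]; apply: sums_in; exists a, w.
Qed.

Lemma kspanZ (M : lmodType A) (s : seq M) (a : K) v :
  kspan s v -> kspan s (a%:A *: v).
Proof.
elim => [|x w [b [u [us ->]]] _ IH]; first by rewrite scaler0; constructor.
rewrite scalerDr scalerA -scalerAl mul1r scalerA.
by apply: sums_cons => //; exists (a * b), u.
Qed.

Lemma kspan_cons (M : lmodType A) w (s : seq M) v : kspan (w :: s) v ->
  exists (a : K) u, kspan s u /\ v = a%:A *: w + u.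
Proof.
elim => [|y z [a [x [+ ->]]] _ [b [u [su ->]]]].
  by exists 0, 0; rewrite !scale0r addr0; split=> //; constructor.
rewrite inE => /orP[/eqP->|xs].
  by exists (a + b), u; rewrite !scalerDl addrA.
exists b, (a%:A *: x + u); split; last by rewrite addrCA.
by apply: sums_cons => //; exists a, x.
Qed.

Lemma kspan_scale (M : lmodType A) (w : M) (s : seq A^o) (r : A) :
  kspan s r -> kspan [seq (z : A) *: w | z <- s] (r *: w).
Proof.
elim=> [|x v [a [z [zs ->]]] _ IH]; first by rewrite scale0r; constructor.
rewrite scalerDl; apply: sums_cons => //.
exists a, ((z : A) *: w); split; last by rewrite scalerA.
by apply/mapP; exists z.
Qed.

Lemma decreasing_seq (T : Type) (W : nat -> set T) :
  (forall e, W e.+1 `<=` W e) ->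
  forall e e', (e <= e')%N -> W e' `<=` W e.
Proof.
move=> WS e e' /subnKC<-; elim: (e' - e)%N => [|m IH]; first by rewrite addn0.
by rewrite addnS; apply: subset_trans (WS _) IH.
Qed.

(* By induction on the dimension, looking at whether all the W e have an element
   with nonzero leading coordinate. *)
Lemma kspan_dcc (M : lmodType A) (s : seq M) (W : nat -> set M) :
  (forall e u v, W e u -> W e v -> W e (u + v)) ->
  (forall e (a : K) u, W e u -> W e (a%:A *: u)) ->
  (forall e, W e 0) ->
  (forall e, W e.+1 `<=` W e) ->
  exists e0, forall e v, (e0 <= e)%N -> kspan s v -> W e0 v -> W e v.
Proof.
move=> WD WZ W0 WS; have Wle := decreasing_seq WS.
elim: s => [|w s [e1 IH]].
  by exists 0%N => e v _; elim=> [|? ? [a [? []]]].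
have [lead|] := pselect (forall e, exists (a : K) u,
    [/\ a != 0, kspan s u & W e (a%:A *: w + u)]).
  exists e1 => e v ee /kspan_cons[a [u [su ->]]] Wv.
  have [b [z [b0 sz Wz]]] := lead e.
  (* This multiple of an element of [W e] has leading coordinate [- a]; adding it to [v] gives an
     element of the span of [s], to which [IH] applies. *)
  pose y := (- (a / b))%:A *: (b%:A *: w + z).
  have yE : a%:A *: w + u + y = u + (- (a / b))%:A *: z.
    rewrite /y scalerDr scalerA -scalerAl mul1r scalerA mulNr divfK//.
    by rewrite !scaleNr addrACA subrr add0r.
  have Wy e' : (e' <= e)%N -> W e' y by move=> le; apply: WZ; exact: Wle Wz.
  have -> : a%:A *: w + u = (a%:A *: w + u + y) + (-1)%:A *: y.
    by rewrite !scaleNr !scale1r addrK.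
  apply: (WD); last by apply: WZ; exact: Wy.
  apply: IH => //; last by apply: WD => //; exact: Wy.
  by rewrite yE; apply: sumsD => //; exact: kspanZ.
move=> /existsNP[e2 He2]; exists (maxn e1 e2) => e v ee.
move=> /kspan_cons[a [u [su ->]]].
have [->|a0] := eqVneq a 0.
  rewrite !scale0r add0r => Wu; apply: IH => //.
    exact: leq_trans (leq_maxl _ _) ee.
  exact: Wle (leq_maxl _ _) _ Wu.
move=> /(Wle _ _ (leq_maxr e1 e2)) Wv; exfalso; apply: He2.
by exists a, u.
Qed.

(** * Finite dimension in bounded degrees *)

Section GradedPieces.
Variable g : nat -> set A.
Hypothesis noethA : noetherian A.
Hypothesis dg : direct_decomposition g.
Hypothesis gM : forall m n a b, g m a -> g n b -> g (m + n)%N (a * b).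
Hypothesis g0 : forall r, g 0%N r -> exists c : K, r = c%:A.

(** Induction on [N]: an element of positive degree is a sum of products of generators with elements
    of lower degree, and 1 spans degree 0. *)
Lemma graded_pieces_finite N :
  exists s : seq A^o, forall n r, (n < N)%N -> g n r -> kspan s r.
Proof.
have [ys gen] := graded_generators noethA dg gM.
elim: N => [|N [s sP]]; first by exists [::].
exists (1 :: s ++ [seq z * y | z <- s, y <- ys]) => n r.
have sub : {subset s <= (1 : A^o) :: s ++ [seq z * y | z <- s, y <- ys]}.
  by move=> z zs; rewrite inE mem_cat zs orbT.
rewrite ltnS leq_eqVlt => /orP[/eqP->|nN gr]; last first.
  by apply: kspan_sub (sP _ _ nN gr).
case: N sP sub => [|N] sP sub gr.
  have [c ->] := g0 gr; apply: sums_in.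
  exists c, (1 : A^o); rewrite mem_head; split=> //.
  by rewrite /GRing.scale/= mulr1.
elim: (gen N.+1 r isT gr) => [|x x' [y [z [m [yys mN gz ->]]]] _].
  by constructor.
apply: (@sumsD A^o).
have := kspan_scale (y : A^o) (sP _ _ mN gz); apply: kspan_sub.
move=> _ /mapP[u us ->]; rewrite inE mem_cat orbC.
by rewrite (allpairs_f (fun z y : A => z * y))// orbT.
Qed.

(** A homogeneous piece of degree [d] of a module generator reaches degrees at most [c] only through
    ring elements of degree at most [c - d], which lie in a finite-dimensional space. *)
Lemma bounded_degree_finite (M : lmodType A) (h : rat -> set M) (c : rat) :
  finitely_generated M -> Qgraded_module g h ->
  exists s : seq M, forall b v, b <= c -> h b v -> kspan s v.
Proof.
move=> [m [a Ma]] [dh hZ]; have [P [PD Pid P0]] := projection_exists dh.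
have P00 b : P b 0 = 0 by rewrite Pid//; exact: (comp0 dh).
have /choice[F FP] : forall w, exists s : seq M, forall r b, b <= c ->
    kspan s (P b (r *: w)).
  move=> w; elim: {w}(decomp_sums dh w) => [|w z [d hw] _ [s sP]].
    by exists [::] => r b _; rewrite scaler0 P00; constructor.
  have [N cN] : exists N, c - d < N%:R.
    exists (Num.bound `|c - d|); apply: le_lt_trans (ler_norm _) _.
    exact: archi_boundP.
  have [t tP] := graded_pieces_finite N.
  exists ([seq (x : A) *: w | x <- t] ++ s) => r b bc.
  rewrite scalerDr PD; apply: sumsD; last first.
    by apply: kspan_sub (sP r b bc) => x xs; rewrite mem_cat xs orbT.
  apply: (@kspan_sub _ [seq (x : A) *: w | x <- t]).
    by move=> x xs; rewrite mem_cat xs.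
  elim: {r}(decomp_sums dg r) => [|r r' [n gr] _ IH].
    by rewrite scale0r P00; constructor.
  rewrite scalerDl PD; apply: sumsD => //.
  have hrw := hZ _ _ _ _ gr hw.
  have [nd|nd] := eqVneq (n%:R + d) b; last first.
    by rewrite (P0 _ _ _ nd hrw); constructor.
  rewrite Pid -?nd//; apply: kspan_scale; apply: (tP n) => //.
  rewrite -(ltr_nat rat); apply: le_lt_trans cN.
  by rewrite lerBrDr nd.
exists (flatten [seq F (a t) | t <- enum 'I_m]) => b v bc hv.
have [r vE] := Ma v; rewrite -(Pid _ _ hv) vE.
have -> : P b (\sum_t r t *: a t) = \sum_t P b (r t *: a t).
  by apply: (big_morph (P b) (PD b) (P00 b)).
apply: sums_sum => t _; apply: kspan_sub (FP (a t) (r t) b bc) => x xF.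
by apply/flatten_mapP; exists t; rewrite ?mem_enum.
Qed.

End GradedPieces.
End FiniteSpan.

(** * Degrees of the powers of an element *)

Section BoundedDegree.
Variables (A : comNzRingType) (g : nat -> set A).
Hypothesis dg : direct_decomposition g.
Hypothesis gM : forall m n a b, g m a -> g n b -> g (m + n)%N (a * b).
Hypothesis g1 : g 0%N 1.

Let degle D := sums [set z | exists2 n, (n <= D)%N & g n z].

Let degle_sub D D' : (D <= D')%N -> degle D `<=` degle D'.
Proof.
move=> DD; apply: sums_min; [constructor | exact: sumsD |].
by move=> z [n nD gz]; apply: sums_in; exists n => //; exact: leq_trans DD.
Qed.

Let degleM D D' u v : degle D u -> degle D' v -> degle (D + D')%N (u * v).
Proof.
move=> Du Dv; elim: Du => [|z u' [n nD gz] _ IH]; first by rewrite mul0r; constructor.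
rewrite mulrDl; apply: sumsD => //.
elim: Dv => [|z' v' [n' nD' gz'] _ IH']; first by rewrite mulr0; constructor.
rewrite mulrDr; apply: sums_cons => //; exists (n + n')%N; first exact: leq_add.
exact: gM.
Qed.

(** Degrees add under products, so a bound [D] on the degrees of the components of [x] serves for
    all powers at once. *)
Lemma expr_degree_bound x : exists D, forall m,
  sums [set z | exists2 n, (n <= D * m)%N & g n z] (x ^+ m).
Proof.
have [D Dx] : exists D, degle D x.
  elim: (decomp_sums dg x) => [|z v [n gz] _ [D Dv]]; first by exists 0%N; constructor.
  exists (maxn n D); apply: sums_cons; first by exists n => //; exact: leq_maxl.
  by apply: degle_sub Dv; exact: leq_maxr.
exists D; elim => [|m IH]; first by apply: sums_in; exists 0%N.
by rewrite exprS mulnS; exact: degleM.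
Qed.

End BoundedDegree.

(** * The operator raising the pole order, over the perfect field *)

Section PoleRaisingOperator.
Variables (p : nat) (K : fieldType) (A : comAlgType K) (g : nat -> set A).
Hypothesis chA : p \in [pchar A].
Hypothesis noethA : noetherian A.
Hypothesis dg : direct_decomposition g.
Hypothesis gM : forall m n a b, g m a -> g n b -> g (m + n)%N (a * b).
Hypothesis g0 : forall r, g 0%N r <-> exists c : K, r = c%:A.

Variables (s : nat) (M : 'I_s -> lmodType A) (h : forall i, rat -> set (M i)).
Arguments h : clear implicits.
Hypothesis fgM : forall i, finitely_generated (M i) /\ Qgraded_module g (h i).

Lemma pchar_prime : prime p.
Proof. by case/andP: chA. Qed.

Definition frob_iso e (n : 'I_s -> nat) (alpha : forall i, 'I_(n i) -> rat)
  (phi : forall i, 'I_(n i) -> {linear frobM chA e A^o -> M i}) :=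
  bijective (fun (r : A) i (j : 'I_(n i)) => phi i j r) /\
    forall (b : rat) (r : A),
      frob_grading p g e b r <->
      (forall i (j : 'I_(n i)), h _ (alpha i j + b) (phi i j r)).

Lemma frob_homP e (N : lmodType A) (phi : {linear frobM chA e A^o -> N}) r y z :
  phi (r ^+ (p ^ e) * y + z) = r *: phi y + phi z.
Proof. exact: (linearP phi r (y : frobM chA e A^o) z). Qed.

(* ^eR lives in nonnegative degrees, so the shift alpha is at most the degree
   of any nonzero homogeneous element of the summand. *)
Lemma shift_bounded e n (alpha : forall i, 'I_(n i) -> rat) phi i l b w :
  @frob_iso e n alpha phi -> h _ b (w : M i) -> w != 0 -> alpha i l <= b.
Proof.
move=> [[psi phiK psiK] gr] hw w0.
(* The preimage of the family with single entry [w] at position [i], [l] is homogeneous of degree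
   [b - alpha i l]. *)
pose F := dfwith (fun i (_ : 'I_(n i)) => 0 : M i)
                 (fun l' : 'I_(n i) => if l' == l then w else 0).
have Fil : F i l = w by rewrite /F dfwith_in eqxx.
have phiF i' l' : phi i' l' (psi F) = F i' l'.
  by rewrite -[RHS](congr1 (fun G => G i' l') (psiK F)).
have /gr[psi0|] : forall i' l',
    h _ (alpha i' l' + (b - alpha i l)) (phi i' l' (psi F)).
  have h0 k c : h k c 0 by have [_ [dh _]] := fgM k; exact: comp0 dh _.
  move=> i' l'; rewrite phiF /F; have [ii|ii] := eqVneq i i'.
    case: _ / ii l' => l'; rewrite dfwith_in.
    by case: eqP => [->|_]; [rewrite addrC subrK | exact: h0].
  by rewrite dfwith_out.
- by move: w0; rewrite -Fil -phiF psi0 raddf0 eqxx.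
move=> [m mE _]; rewrite -subr_ge0.
have q0 : (0 : rat) < (p ^ e)%:R.
  by rewrite ltr0n expn_gt0 prime_gt0 ?pchar_prime.
by rewrite -(pmulr_rge0 _ q0) mE ler0n.
Qed.

(** With q = p^e, a degree [d] component of the power of [x] has degree [d / q] in ^eA, hence at
    most [D], and the shift is at most the degree [b] of a fixed nonzero homogeneous element of
    [M i]. The bound [b + D] is independent of [e]. *)
Lemma coordinates_finite x i : exists t : seq (M i),
  forall e n (alpha : forall i, 'I_(n i) -> rat) phi,
    @frob_iso e n alpha phi -> forall l e', (e' <= e)%N ->
    kspan t (phi i l (x ^+ (p ^ e - p ^ e'))).
Proof.
(* A zero module has no nonzero homogeneous element to bound the shifts with. *)
have [Mi0|/existsNP[v /eqP v0]] := pselect (forall v : M i, v = 0).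
  by exists [::] => e n alpha phi _ l e' _; rewrite [phi _ _ _]Mi0; constructor.
have [fg_i qg_i] := fgM i; have [dh _] := qg_i.
have [b [w [hw w0]]] : exists b w, h _ b (w : M i) /\ w != 0.
  have [//|nh] := pselect (exists b w, h _ b (w : M i) /\ w != 0).
  case/eqP: v0; elim: (decomp_sums dh v) => // w u [b hw] _ ->.
  rewrite addr0; apply/eqP; apply: contrapT => /negP w0.
  by apply: nh; exists b, w.
have g1 : g 0%N 1 by apply/g0; exists 1; rewrite scale1r.
have [D DP] := expr_degree_bound dg gM g1 x.
have g0' r : g 0%N r -> exists c : K, r = c%:A by move/g0.
have [t tP] := bounded_degree_finite noethA dg gM g0' (b + D%:R) fg_i qg_i.
exists t => e n alpha phi iso l e' ee.
have ab := shift_bounded l iso hw w0.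
have [_ gr] := iso.
have phiD u v' : phi i l (u + v') = phi i l u + phi i l v' by exact: raddfD.
have phi0 : phi i l 0 = 0 by exact: raddf0.
elim: {v v0}(DP (p ^ e - p ^ e')%N) => [|z u [d dD gz] _ IH].
  by rewrite phi0; constructor.
rewrite phiD; apply: sumsD => //.
have q0 : (0 : rat) < (p ^ e)%:R.
  by rewrite ltr0n expn_gt0 prime_gt0 ?pchar_prime.
apply: (tP (alpha i l + d%:R / (p ^ e)%:R)).
  apply: lerD => //; rewrite ler_pdivrMr// -natrM ler_nat.
  by apply: leq_trans dD _; rewrite leq_mul2l leq_subr orbT.
apply: (proj1 (gr _ z)); right; exists d => //.
by rewrite mulrC divfK// gt_eqF.
Qed.

(* phi ranges over the homomorphisms ^eA -> M i. *)
Let N (x : A) i e : set (M i) := [set v | exists2 phi : A -> M i,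
  (forall r y z, phi (r ^+ (p ^ e) * y + z) = r *: phi y + phi z) &
  phi (x ^+ (p ^ e - 1)) = v].

Let FrobD m (y z : A) : (y + z) ^+ (p ^ m) = y ^+ (p ^ m) + z ^+ (p ^ m).
Proof. by rewrite exprDn_pchar// pnatX pnatE ?pchar_prime// chA. Qed.

(** For q = p^e and q' = p^m, x^(qq'-q') is the q'-th power of x^(q-1), so precomposing [phi] with
    the q'-th power map lowers the level from [e + m] to [e]. *)
Let NS x i e m phi :
  (forall r y z, phi (r ^+ (p ^ (e + m)) * y + z) = r *: phi y + phi z :> M i) ->
  N x (i:=i) e (phi (x ^+ (p ^ (e + m) - p ^ m))).
Proof.
move=> phiP; exists (fun y => phi (y ^+ (p ^ m))).
  by move=> r y z; rewrite FrobD exprMn -exprM -expnD phiP.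
by rewrite -exprM mulnBl mul1n expnD.
Qed.

Let N_decr x i e : N x (i:=i) e.+1 `<=` N x (i:=i) e.
Proof.
move=> _ [f fP <-].
(* For q = p^e, x^(q-1) goes to x^(pq-1), since (p-1) + p(q-1) = pq - 1. *)
exists (fun y => f (x ^+ p.-1 * y ^+ (p ^ 1))).
  move=> r y z; rewrite FrobD mulrDr exprMn -exprM -expnSr mulrCA; exact: fP.
rewrite -exprM -exprD; congr (f (x ^+ _)).
have p0 := prime_gt0 pchar_prime.
rewrite mulnBl -expnSr expn1 mul1n -subn1 addnC addnBA// subnK//.
by rewrite expnS leq_pmulr// expn_gt0 p0.
Qed.

(** Once each coordinate of x^(q-q') is the image of x^(q-1) under a homomorphism from ^eA to [M i],
    these homomorphisms assemble, through the inverse isomorphism, into an endomorphism of ^eA. *)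
Lemma exists_pole_raising_operator x e' :
  (forall e, exists n alpha phi, @frob_iso e n alpha phi) ->
  exists e (d : A -> A), [/\ (e' <= e)%N,
  forall r y z, d (r ^+ (p ^ e) * y + z) = r ^+ (p ^ e) * d y + d z &
  d (x ^+ (p ^ e - 1)) = x ^+ (p ^ e - p ^ e')].
Proof.
move=> ffrt.
have /choice/=[e0 stab] : forall i, exists e0, forall e v, (e0 <= e)%N ->
    kspan (projT1 (cid (coordinates_finite x i))) v -> N x e0 v -> N x (i:=i) e v.
  move=> i; apply: kspan_dcc.
  - move=> e u v [f fP <-] [f' fP' <-]; exists (fun y => f y + f' y) => // r y z.
    by rewrite fP fP' scalerDr addrACA.
  - move=> e a u [f fP <-]; exists (fun y => a%:A *: f y) => // r y z.
    by rewrite fP scalerDr !scalerA mulrC.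
  - by move=> e; exists (fun=> 0) => // r y z; rewrite scaler0 addr0.
  - exact: N_decr.
(* At level [E + e'], [NS] puts the coordinates in [N] at level [E], hence at level [e0 i], and
   stabilization brings them back to level [E + e']. *)
pose E := \max_i e0 i.
exists (E + e')%N.
have [n [alpha [phi iso]]] := ffrt (E + e')%N.
have coordN i l : exists f : A -> M i,
    (forall r y z, f (r ^+ (p ^ (E + e')) * y + z) = r *: f y + f z) /\
    f (x ^+ (p ^ (E + e') - 1)) = phi i l (x ^+ (p ^ (E + e') - p ^ e')).
  suff [f fP fE] : N x (E + e') (phi i l (x ^+ (p ^ (E + e') - p ^ e'))).
    by exists f.
  apply: (stab i); first exact: leq_trans (leq_bigmax i) (leq_addr _ _).
    case: cid => t tP /=; apply: tP iso _ _ _; exact: leq_addl.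
  apply: (decreasing_seq (@N_decr x i) (leq_bigmax i)).
  by apply: NS => r y z; exact: frob_homP.
pose F i l := projT1 (cid (coordN i l)).
have FP i l := projT2 (cid (coordN i l)).
have [[psi phiK psiK] _] := iso.
pose d y := psi (fun i l => F i l y).
have phid y i l : phi i l (d y) = F i l y.
  by rewrite -[RHS](congr1 (fun G => G i l) (psiK (fun i l => F i l y))).
have phi_inj y z : (forall i l, phi i l y = phi i l z) -> y = z.
  move=> yz; rewrite -[y]phiK -[z]phiK; congr psi.
  by apply: functional_extensionality_dep => i; apply/funext => l; exact: yz.
exists d; split; first exact: leq_addl.
- move=> r y z; apply: phi_inj => i l.
  by rewrite frob_homP !phid; exact: (FP i l).1.
- apply: phi_inj => i l; rewrite phid; exact: (FP i l).2.
Qed.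

End PoleRaisingOperator.


(** * Retracting from [K] to [k], and from [RK] to [R] *)

Section Retraction.
Variables (k K : fieldType) (i : {rmorphism k -> K}).

(* A k-subspace W of K that is maximal among those avoiding 1 is a complement
   of the image of k. *)
Lemma linear_retraction : exists pi : K -> k,
  (forall c a a', pi (i c * a + a') = c * pi a + pi a') /\ pi 1 = 1.
Proof.
(* The empty set satisfies [P], as Zorn's lemma demands for the empty chain; hence the alternative
   [w = 0 \/ W w] until [W0] is proved. *)
pose P : set (set K) := [set W |
  (forall c a a', W a -> W a' -> W (i c * a + a')) /\ ~ W 1].
have [W [[Wlin W1] Wmax]] : exists W, P W /\ forall B, W `<` B -> ~ P B.
  apply: Zorn_bigcup => F FP Ftot; split; last by move=> [X /FP[_]].
  move=> c a a' [X FX Xa] [Y FY Ya'].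
  have [XY|YX] := Ftot _ _ FX FY.
    by exists Y => //; have [Ylin _] := FP _ FY; apply: Ylin => //; exact: XY.
  by exists X => //; have [Xlin _] := FP _ FX; apply: Xlin => //; exact: YX.
have adjoin v : ~ W v -> exists c w, (w = 0 \/ W w) /\ 1 = i c * v + w.
  move=> Wv; apply: contrapT => nex.
  apply: (Wmax [set z | exists c w, (w = 0 \/ W w) /\ z = i c * v + w]).
    split; last by move=> /(_ v); apply: contra_not Wv; apply; exists 1, 0;
                   rewrite rmorph1 mul1r addr0; split=> //; left.
    by move=> w Ww; exists 0, w; rewrite rmorph0 mul0r add0r; split=> //; right.
  split; last by [].
  move=> c _ _ [b [w [w0 ->]]] [b' [w' [w0' ->]]].
  exists (c * b + b'), (i c * w + w'); split; last first.
    by rewrite rmorphD rmorphM; ring.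
  case: w0 => [->|Ww]; case: w0' => [->|Ww'].
  - by left; rewrite mulr0 addr0.
  - by right; rewrite mulr0 add0r.
  - have W0 : W 0 by have := Wlin (-1) _ _ Ww Ww; rewrite rmorphN1 mulN1r addNr.
    by right; exact: Wlin.
  - by right; exact: Wlin.
have W0 : W 0.
  apply: contrapT => /adjoin[c [w [w0]]]; rewrite mulr0 add0r => w1.
  by case: w0 => [w0|Ww]; [have := oner_neq0 K; rewrite w1 w0 eqxx | rewrite -w1 in Ww].
have WZ c a : W a -> W (i c * a) by move=> Wa; rewrite -[_ * _]addr0; exact: Wlin.
(* For [v] outside [W], 1 = cv + w gives v - 1/c = -w/c, which lies in [W]. *)
have /choice[pi piP] : forall v, exists c, W (v - i c).
  move=> v; have [Wv|/adjoin[c [w [w0]]] E] := pselect (W v).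
    by exists 0; rewrite rmorph0 subr0.
  have {w0}Ww : W w by case: w0 => [->|].
  have c0 : c != 0.
    by apply/eqP => c0; move: E; rewrite c0 rmorph0 mul0r add0r => E; rewrite -E in Ww.
  exists c^-1; have -> : v - i c^-1 = i (- c^-1) * w.
    rewrite rmorphN fmorphV; have ic0 : i c != 0 by rewrite fmorph_eq0.
    by rewrite -[X in _ - X]mulr1 E mulrDr mulKf// opprD addNKr mulNr.
  exact: WZ.
(* Otherwise [W] contains a nonzero scalar, and hence 1 after rescaling. *)
have pi_uniq v c : W (v - i c) -> pi v = c.
  move=> Wc; apply/eqP; rewrite -subr_eq0; apply/eqP.
  apply: contrapT => /eqP d0; apply: W1.
  have := WZ (pi v - c)^-1 _ (Wlin (-1) _ _ (piP v) Wc).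
  rewrite rmorphN1 mulN1r opprB addrA subrK -rmorphB -rmorphM mulVf// rmorph1.
  by [].
exists pi; split.
- move=> c a a'; apply: pi_uniq; rewrite rmorphD rmorphM.
  have -> : i c * a + a' - (i c * i (pi a) + i (pi a')) =
            i c * (a - i (pi a)) + (a' - i (pi a')) by ring.
  exact: Wlin.
- by apply: pi_uniq; rewrite rmorph1 subrr.
Qed.

(** [F] sends the tensor of [r] and [a] to [pi a *: r]. Its [R]-linearity comes from uniqueness in
    the universal property: multiplying by [s] before or after [F] represents the same bilinear
    map. *)
Lemma tensor_retraction (R : comAlgType k) (RK : comAlgType K)
    (j : {rmorphism R -> RK}) : is_tensor_algebra i j ->
  exists F : RK -> R,
    [/\ forall c z z', F (i c *: z + z') = c *: F z + F z',
        forall r z, F (j r * z) = r * F z & forall r, F (j r) = r].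
Proof.
move=> [_ univ]; have [pi [pi_lin pi1]] := linear_retraction.
have bil s : k_bilinear i (fun (r : R) a => pi a *: (s * r)).
  split=> [a c r r'|r c a a'].
    by rewrite mulrDr scalerDr -scalerAr !scalerA mulrC.
  by rewrite pi_lin scalerDl scalerA.
have [F [[F_lin FE] _]] := univ R _ (bil 1).
exists F; split=> // [s z|r]; last first.
  by rewrite -[j r]scale1r FE pi1 scale1r mul1r.
have [G [_ Guniq]] := univ R _ (bil s).
have G1 : G = (fun z => F (j s * z)).
  apply: Guniq; split=> [c u v|r a].
    by rewrite mulrDr -scalerAr F_lin.
  by rewrite -scalerAr -rmorphM FE mul1r.
have G2 : G = (fun z => s * F z).
  apply: Guniq; split=> [c u v|r a].
    by rewrite F_lin mulrDr -scalerAr.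
  by rewrite FE mul1r -scalerAr.
by rewrite -[LHS]/((fun z => F (j s * z)) z) -G1 G2.
Qed.

End Retraction.

(** * Frobenius-linear maps are differential operators *)

Section DifferentialOperators.
Variables (k : fieldType) (R : comAlgType k).

Let ad (r : R) (d : R -> R) (y : R) : R := d (r * y) - r * d y.

Let klinear (d : R -> R) :=
  forall (c : k) y z, d (c *: y + z) = c *: d y + d z.

Let klinear0 : klinear (fun=> 0).
Proof. by move=> c y z; rewrite scaler0 addr0. Qed.

Let ad_klinear r d : klinear d -> klinear (ad r d).
Proof.
move=> dk c y z; rewrite /ad mulrDr -scalerAr !dk mulrDr -scalerAr scalerBr.
by rewrite opprD addrACA.
Qed.

Lemma diffop_lt0 n : @diffop_lt k R n (fun=> 0).
Proof.
elim: n => //= n IH; split=> // r; set d := (X in diffop_lt n X).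
suff -> : d = fun=> 0 by [].
by apply/funext => y; rewrite /d mulr0 subr0.
Qed.

Lemma diffop_ltD n (d d' : R -> R) : diffop_lt n d -> diffop_lt n d' ->
  diffop_lt n (fun y => d y + d' y).
Proof.
elim: n d d' => [|n IH] d d' /=; first by move=> d0 d0' y; rewrite d0 d0' addr0.
move=> [dk dn] [dk' dn']; split=> [c y z|r].
  by rewrite dk dk' scalerDr addrACA.
have := IH _ _ (dn r) (dn' r); set e := (X in diffop_lt n X -> _) => en.
set e' := (X in diffop_lt n X); suff -> : e' = e by [].
by apply/funext => y; rewrite /e /e'; ring.
Qed.

(** Together with [diffop_ltMr], this handles the two terms of the Leibniz rule for the commutator
    with a product. *)
Lemma diffop_ltMl n s (d : R -> R) :
  diffop_lt n d -> diffop_lt n (fun y => s * d y).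
Proof.
elim: n d => [|n IH] d /=; first by move=> d0 y; rewrite d0 mulr0.
move=> [dk dn]; split=> [c y z|r]; first by rewrite dk mulrDr scalerAr.
have := IH _ (dn r); set e := (X in diffop_lt n X -> _) => en.
set e' := (X in diffop_lt n X); suff -> : e' = e by [].
by apply/funext => y; rewrite /e /e'; ring.
Qed.

Lemma diffop_ltMr n s (d : R -> R) :
  diffop_lt n d -> diffop_lt n (fun y => d (s * y)).
Proof.
elim: n d => [|n IH] d /=; first by move=> d0 y; rewrite d0.
move=> [dk dn]; split=> [c y z|r]; first by rewrite mulrDr -scalerAr dk.
have := IH _ (dn r); set e := (X in diffop_lt n X -> _) => en.
set e' := (X in diffop_lt n X); suff -> : e' = e by [].
by apply/funext => y; rewrite /e /e' [s * (r * y)]mulrCA.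
Qed.

(** Hence applying [ad y] once preserves the nilpotency exponents of the other generators. *)
Let adC r s d : ad r (ad s d) = ad s (ad r d).
Proof. by apply/funext => y; rewrite /ad [s * (r * y)]mulrCA; ring. Qed.

Let ad0 r : ad r (fun=> 0) = fun=> 0.
Proof. by apply/funext => y; rewrite /ad mulr0 subr0. Qed.

Variables (g : nat -> set R) (p : nat).
Hypothesis chR : p \in [pchar R].
Hypothesis noethR : noetherian R.
Hypothesis dg : direct_decomposition g.
Hypothesis gM : forall m n a b, g m a -> g n b -> g (m + n)%N (a * b).
Hypothesis g0 : forall r, g 0%N r -> exists c : k, r = c%:A.

(* [-, y] generates the ideal of the diagonal as y runs through algebra
   generators, so nilpotency of each [-, y] on d suffices. *)
Lemma ad_nilpotent_diffop (ys : seq R) :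
  (forall S : set R,
  (forall u v, S u -> S v -> S (u + v)) ->
  (forall u v, S u -> S v -> S (u * v)) ->
  (forall u, g 0%N u -> S u) -> (forall y, y \in ys -> S y) -> forall v, S v) ->
  forall n (a : R -> nat) d, klinear d ->
  (forall y, y \in ys -> iter (a y) (ad y) d = fun=> 0) ->
  (\sum_(y <- ys) a y < n)%N -> diffop_lt n d.
Proof.
move=> gen; elim=> // n IH a d dk da an; split=> //.
have dD u v : d (u + v) = d u + d v by rewrite -[u]scale1r dk !scale1r.
(* The [r] whose commutator with [d] satisfies [diffop_lt n] form a [k]-subalgebra, by [d, uv] =
   [d, u]v + u[d, v], so generators suffice. *)
apply: gen => [u v Su Sv|u v Su Sv|u /g0[c ->]|y yys].
- have := diffop_ltD Su Sv; set e := (X in diffop_lt n X -> _) => en.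
  set e' := (X in diffop_lt n X); suff -> : e' = e by [].
  by apply/funext => y; rewrite /e /e' mulrDl dD; ring.
- have := diffop_ltD (diffop_ltMr v Su) (diffop_ltMl u Sv).
  set e := (X in diffop_lt n X -> _) => en.
  set e' := (X in diffop_lt n X); suff -> : e' = e by [].
  by apply/funext => y; rewrite /e /e' -mulrA; ring.
- set e := (X in diffop_lt n X); suff -> : e = fun=> 0 by exact: diffop_lt0.
  apply/funext => y; rewrite /e -!scalerAl !mul1r -[c *: y]addr0 dk.
  have -> : d 0 = 0 by have := dk (-1) 0 0; rewrite scaler0 addr0 scaleN1r addNr.
  by rewrite addr0 subrr.
- rewrite -/(ad y d).
  case ay: (a y) => [|m].
    by have := da y yys; rewrite ay /= => ->; rewrite ad0; exact: diffop_lt0.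
  (* Passing to [ad y d] lowers the exponent of [y] by one, bringing the sum below [n]. *)
  apply: (IH (fun x => if x == y then m else a x)); first exact: ad_klinear.
    move=> x xys; have itC l : iter l (ad x) (ad y d) = ad y (iter l (ad x) d).
      by elim: l => //= l ->; rewrite adC.
    have [->|_] := eqVneq x y; last by rewrite itC da.
    by rewrite -iterSr -ay da.
  rewrite -ltnS; apply: leq_trans an; rewrite ltnS.
  rewrite (big_rem y)//= eqxx [X in (_ < X)%N](big_rem y)//=.
  rewrite ay addSn ltnS leq_add2l; apply: leq_sum => x _.
  by case: eqP => // ->; rewrite ay leqnSn.
Qed.

(* Expanding ('X - y) ^ m, with 'X acting by d |-> d (y * -). *)
Let iter_adE y d z m : iter m (ad y) d z =
  \sum_(l < m.+1) (('X - y%:P) ^+ m)`_l * d (y ^+ l * z).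
Proof.
elim: m d => [|m IH] d; first by rewrite big_ord1 !expr0 coef1 !mul1r.
rewrite iterSr IH exprS; set Q := ('X - y%:P) ^+ m.
under [RHS]eq_bigr do rewrite mulrBl coefB coefCM coefXM mulrBl.
rewrite sumrB [X in _ = X - _]big_ord_recl/= mul0r add0r.
rewrite [X in _ = _ - X]big_ord_recr/= [Q`_m.+1]nth_default ?size_exp_XsubC//.
rewrite mulr0 mul0r addr0 -sumrB; apply: eq_bigr => l _.
by rewrite /ad /bump/= add1n exprS -!mulrA; ring.
Qed.

(** For q = p^e, (X - y)^q = X^q - y^q in characteristic p, so the expansion reduces to d(y^q z) -
    y^q d(z), which vanishes. *)
Lemma ad_frob y d e : frob_linear p e d -> iter (p ^ e) (ad y) d = fun=> 0.
Proof.
move=> dq; have p0 : (0 < p ^ e)%N.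
  by rewrite expn_gt0 prime_gt0//; case/andP: chR.
apply/funext => z; rewrite iter_adE.
have -> : ('X - y%:P) ^+ (p ^ e) = 'X^(p ^ e) - (y ^+ (p ^ e))%:P.
  have chP : [pchar {poly R}].-nat (p ^ e)%N.
    rewrite pnatX pnatE; last by case/andP: chR.
    by rewrite pchar_poly chR.
  by apply/eqP; rewrite eq_sym subr_eq rmorphXn -exprDn_pchar// subrK.
have q0 : (0 < p ^ e)%N by [].
case: (p ^ e)%N q0 (dq y z) => // q _ dyz.
rewrite big_ord_recr big_ord_recl big1/= => [|l _].
  rewrite !coefB !coefXn !coefC !eqxx/= addr0 subr0 sub0r expr0 !mul1r dyz.
  by rewrite mulNr addNr.
rewrite coefB coefXn coefC/= /bump/= add1n eqSS ltn_eqF//.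
by rewrite subrr mul0r.
Qed.

Lemma frob_linear_diffop d e : klinear d -> frob_linear p e d -> diffop d.
Proof.
move=> dk dq; have [ys gen] := graded_algebra_fg noethR dg gM.
(* All exponents are [p ^ e]; the successor makes the bound on their sum strict. *)
exists (\sum_(y <- ys) p ^ e).+1.
by apply: (ad_nilpotent_diffop gen (a := fun=> (p ^ e)%N)) => // y _; exact: ad_frob.
Qed.

End DifferentialOperators.

(** * Descent of the operator to [R] and its action on 1/x *)

Theorem corollary2p10 (p : nat) (k : fieldType) (R : comAlgType k)
  (gR : nat -> set R) (K : fieldType) (i : {rmorphism k -> K})
  (RK : comAlgType K) (j : {rmorphism R -> RK}) :
  p \in [pchar k] ->
  noetherian_graded_ring p gR ->
  (forall r : R, gR 0%N r <-> exists c : k, r = c%:A) ->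
  is_perfect_closure p i ->
  is_tensor_algebra i j ->
  has_graded_FFRT p (tensor_grading j gR) ->
  forall (x : R), GRing.lreg x ->
  forall (L : comUnitRingType) (f : {rmorphism R -> L}),
  is_localization x f ->
  forall u : L, exists2 d : R -> R, diffop d & loc_act p x f d (f x)^-1 = u.
Proof.
move=> _ [chR noethR dR gRM] gR0 [perf _] tens [[chRK noethRK dRK gRKM]].
move=> [s [M [h [fgM ffrt]]]] x _ L f Lx u.
have p_pr : prime p by case/andP: chR.
have jZ := tens.1.
have [F [F_lin FM FK]] := tensor_retraction tens.
have gRK0 r : tensor_grading j gR 0%N r <-> exists c : K, r = c%:A.
  split=> [[m [z [a [gz ->]]]]|[c ->]].
    have /choice[b bP] : forall l, exists c : k, z l = c%:A by move=> l; apply/gR0.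
    exists (\sum_l a l * i (b l)); rewrite scaler_suml; apply: eq_bigr => l _.
    by rewrite bP jZ rmorph1 scalerA.
  exists 1%N, (fun=> 1), (fun=> c); split=> [l|].
    by apply/gR0; exists 1; rewrite scale1r.
  by rewrite big_ord1 rmorph1.
have [y [n ->]] := loc_surj Lx u.
(* Taking [e' = n] makes [D] send x^(q-1) to x^(q-p^n), where q = p^e; as p^n >= n, the factor y
   x^(p^n-n) then leads to y x^(q-n). *)
have [e [D [ne Dlin Dx]]] :=
  exists_pole_raising_operator noethRK dRK gRKM gRK0 fgM (j x) n ffrt.
have p0 : (0 < p ^ e)%N by rewrite expn_gt0 prime_gt0.
(* Every scalar of the perfect field is a q-th power, so [D], linear over q-th powers, is
   [K]-linear. *)
have root (a : K) : exists b : K, b ^+ (p ^ e) = a.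
  elim: e {ne Dlin Dx p0} a => [|e IH] a; first by exists a.
  have [b <-] := perf a; have [c <-] := IH b.
  by exists c; rewrite expnSr exprM.
have D0 : D 0 = 0.
  by apply: (addrI (D 0)); have := Dlin 1 0 0; rewrite expr1n !mul1r !addr0.
have DZ a z : D (a *: z) = a *: D z.
  have [b <-] := root a; have := Dlin (b%:A) z 0.
  by rewrite exprZn expr1n -!scalerAl !mul1r !addr0 D0 addr0.
have DD z z' : D (z + z') = D z + D z'.
  by have := Dlin 1 z z'; rewrite expr1n !mul1r.
have DM r z : D (r ^+ (p ^ e) * z) = r ^+ (p ^ e) * D z.
  by have := Dlin r z 0; rewrite D0 !addr0.
(* Restrict [D] along [j], retract to [R] by [F], then multiply by the factor turning 1/x^(p^n) into
   y/x^n. *)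
pose d z := y * (x ^+ (p ^ n - n) * F (D (j z))).
have dq : frob_linear p e d.
  move=> r z; rewrite /d rmorphM rmorphXn DM -rmorphXn FM.
  by rewrite [X in y * X]mulrCA [LHS]mulrCA.
have dk c z z' : d (c *: z + z') = c *: d z + d z'.
  by rewrite /d rmorphD jZ DD DZ F_lin !mulrDr -!scalerAr.
have gR0' r : gR 0%N r -> exists c : k, r = c%:A by move/gR0.
exists d; first exact: frob_linear_diffop chR noethR dR gRM gR0' _ _ dk dq.
have -> : (f x)^-1 = f 1 / f (x ^+ 1) by rewrite rmorph1 expr1 mul1r.
(* The action on 1/x is d(x^(q-1)) / x^q, with d(x^(q-1)) = y x^(q-n). *)
rewrite (loc_actE _ _ (prime_gt0 p_pr) Lx dq) !expr1 mulr1 /d.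
rewrite [j (_ ^+ _)]rmorphXn -subn1 Dx -[j x ^+ _]rmorphXn FK.
have np : (n <= p ^ n)%N by rewrite ltnW// ltn_expl// prime_gt1.
have npe : (p ^ n <= p ^ e)%N by rewrite leq_exp2l// prime_gt1.
rewrite -exprD.
have E : (p ^ n - n + (p ^ e - p ^ n) = p ^ e - n)%N.
  by rewrite addnC addnBA// subnK.
have Ux m : f (x ^+ m) \is a GRing.unit by rewrite rmorphXn unitrX// (loc_unit Lx).
rewrite E; apply: (mulIr (Ux (p ^ e)%N)); rewrite divrK// -mulrA rmorphM.
have -> : f (x ^+ (p ^ e)) = f (x ^+ n) * f (x ^+ (p ^ e - n)).
  by rewrite -rmorphM -exprD subnKC// (leq_trans np).
by rewrite mulKr.
Qed.
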